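(* Let $T=\{1243,1324,3142\}$. Then $$F_T(x)=\frac{1-3x+x^2}{1-x}\,C^3(x).$$
   Context: $S_n(T)$ denotes the set of permutations $\pi$ of $[n]=\{1,\dots,n\}$ (one-line notation) that avoid every pattern $\tau\in T$, i.e. no subsequence of $\pi$ is order-isomorphic to $\tau$. $F_T(x)=\sum_{n\ge 0}|S_n(T)|x^n$, a formal power series, with $|S_0(T)|=1$. $C(x)=\frac{1-\sqrt{1-4x}}{2x}=\sum_{n\ge0}\frac{1}{n+1}\binom{2n}{n}x^n$ is the generating function of the Catalan numbers, and $C^3(x)=(C(x))^3$. *)

(* Defs.v *)
From HB Require Import structures.
From mathcomp Require Import all_boot all_order all_algebra all_fingroup.
From mathcomp Require Import boolp.

Set Implicit Arguments.
Unset Strict Implicit.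
Unset Printing Implicit Defensive.

Import GRing.Theory.
Local Open Scope ring_scope.

Record fps (F : fieldType) := FPS { fps_coef : nat -> F }.

Section FormalPowerSeries.
Variable F : fieldType.
Implicit Types a b c : fps F.

(* Equality of series is not decidable; the ring hierarchy's decidable equality
   and choice are obtained classically. *)
HB.instance Definition _ := gen_eqMixin (fps F).
HB.instance Definition _ := gen_choiceMixin (fps F).

Lemma fpsP a b : fps_coef a =1 fps_coef b -> a = b.
Proof. by case: a => f; case: b => g /= /funext ->. Qed.

Definition fps_zero : fps F := FPS (fun _ => 0).
Definition fps_one : fps F := FPS (fun n => (n == 0)%:R).
Definition fps_opp a : fps F := FPS (fun n => - fps_coef a n).
Definition fps_add a b : fps F := FPS (fun n => fps_coef a n + fps_coef b n).
Definition fps_mul a b : fps F :=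
  FPS (fun n => \sum_(i < n.+1) fps_coef a i * fps_coef b (n - i)).

Lemma fps_addA : associative fps_add.
Proof. by move=> a b c; apply: fpsP => n /=; rewrite addrA. Qed.
Lemma fps_addC : commutative fps_add.
Proof. by move=> a b; apply: fpsP => n /=; rewrite addrC. Qed.
Lemma fps_add0 : left_id fps_zero fps_add.
Proof. by move=> a; apply: fpsP => n /=; rewrite add0r. Qed.
Lemma fps_addN : left_inverse fps_zero fps_opp fps_add.
Proof. by move=> a; apply: fpsP => n /=; rewrite addNr. Qed.

HB.instance Definition _ :=
  GRing.isZmodule.Build (fps F) fps_addA fps_addC fps_add0 fps_addN.

Definition fps_trunc m a : {poly F} := \poly_(i < m.+1) fps_coef a i.

Lemma coef_fps_trunc m a n : (n <= m)%N -> (fps_trunc m a)`_n = fps_coef a n.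
Proof. by move=> le_nm; rewrite coef_poly ltnS le_nm. Qed.

Lemma fps_coef_mul_trunc m a b n : (n <= m)%N ->
  fps_coef (fps_mul a b) n = (fps_trunc m a * fps_trunc m b)`_n.
Proof.
move=> le_nm; rewrite coefM /=; apply: eq_bigr => i _.
rewrite !coef_fps_trunc ?(leq_trans (leq_subr _ _)) //.
by rewrite (leq_trans _ le_nm) // -ltnS.
Qed.

Lemma fps_mulC : commutative fps_mul.
Proof.
by move=> a b; apply: fpsP => n; rewrite !(fps_coef_mul_trunc _ _ (leqnn n)) mulrC.
Qed.

Lemma fps_mulA : associative fps_mul.
Proof.
move=> a b c; apply: fpsP => n.
suff [-> ->] : fps_coef (fps_mul a (fps_mul b c)) n =
    (fps_trunc n a * (fps_trunc n b * fps_trunc n c))`_n /\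
  fps_coef (fps_mul (fps_mul a b) c) n =
    (fps_trunc n a * fps_trunc n b * fps_trunc n c)`_n by rewrite mulrA.
split; rewrite coefM [LHS]/=; apply: eq_bigr => i _.
- have le_in : (i <= n)%N by rewrite -ltnS.
  by rewrite coef_fps_trunc // -(fps_coef_mul_trunc _ _ (leq_subr i n)).
- have le_in : (i <= n)%N by rewrite -ltnS.
  by rewrite coef_fps_trunc ?leq_subr // -fps_coef_mul_trunc.
Qed.

Lemma fps_mul1 : left_id fps_one fps_mul.
Proof.
move=> a; apply: fpsP => n /=; rewrite big_ord_recl /= mul1r subn0.
by rewrite big1 ?addr0 // => i _; rewrite mul0r.
Qed.

Lemma fps_mulDl : left_distributive fps_mul fps_add.
Proof.
move=> a b c; apply: fpsP => n /=; rewrite -big_split /=.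
by apply: eq_bigr => i _; rewrite mulrDl.
Qed.

Lemma fps_one_neq0 : fps_one != 0.
Proof.
apply/eqP => /(congr1 (fun a => fps_coef a 0)) /= /eqP.
by rewrite oner_eq0.
Qed.

HB.instance Definition _ := GRing.Zmodule_isComNzRing.Build (fps F)
  fps_mulA fps_mulC fps_mul1 fps_mulDl fps_one_neq0.

Lemma fps_coefM a b n :
  fps_coef (a * b) n = \sum_(i < n.+1) fps_coef a i * fps_coef b (n - i).
Proof. by []. Qed.

Lemma fps_coefD a b n : fps_coef (a + b) n = fps_coef a n + fps_coef b n.
Proof. by []. Qed.

Lemma fps_coefN a n : fps_coef (- a) n = - fps_coef a n.
Proof. by []. Qed.

Lemma fps_coef1 n : fps_coef (1 : fps F) n = (n == 0)%:R.
Proof. by []. Qed.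

Definition fps_const (k : F) : fps F := FPS (fun n => if n is 0 then k else 0).

Definition fps_unit : {pred fps F} := fun a => fps_coef a 0 != 0.

(* [fps_geom u] is the sum of all powers of [u] when [u] has zero constant
   term: [u ^+ k] then contributes nothing below degree [k]. *)
Definition fps_geom (u : fps F) : fps F :=
  FPS (fun n => fps_coef (\sum_(k < n.+1) u ^+ k) n).

Definition fps_inv a : fps F :=
  if fps_coef a 0 == 0 then a
  else let k := fps_const (fps_coef a 0)^-1 in k * fps_geom (1 - k * a).

Lemma fps_coefX_small (u : fps F) k n :
  fps_coef u 0 = 0 -> (n < k)%N -> fps_coef (u ^+ k) n = 0.
Proof.
move=> u0; elim: k n => [|k IHk] // n lt_nk.
rewrite exprS fps_coefM big1 // => -[[|i] lt_in] _ /=; first by rewrite u0 mul0r.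
rewrite IHk ?mulr0 //; case: n lt_nk lt_in => [|n] lt_nk lt_in //.
by rewrite subSS (leq_ltn_trans (leq_subr _ _)).
Qed.

Lemma fps_coef_sum (I : Type) (r : seq I) (f : I -> fps F) n :
  fps_coef (\sum_(i <- r) f i) n = \sum_(i <- r) fps_coef (f i) n.
Proof. by elim/big_rec2: _ => // i x y _ <-. Qed.

Lemma fps_geomE (u : fps F) : fps_coef u 0 = 0 -> fps_geom u * (1 - u) = 1.
Proof.
move=> u0; apply: fpsP => n.
have geomE j : (j <= n)%N ->
    fps_coef (fps_geom u) j = fps_coef (\sum_(k < n.+1) u ^+ k) j.
  move=> le_jn /=; rewrite !fps_coef_sum.
  rewrite -!(big_mkord xpredT (fun k => fps_coef (u ^+ k) j)).
  rewrite [RHS](big_cat_nat (n := j.+1)) //= -[LHS]addr0; congr (_ + _).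
  rewrite big_nat_cond big1 // => k /andP[/andP[lt_jk _] _].
  exact: fps_coefX_small.
have -> : fps_coef (fps_geom u * (1 - u)) n =
    fps_coef ((\sum_(k < n.+1) u ^+ k) * (1 - u)) n.
  by rewrite !fps_coefM; apply: eq_bigr => i _; rewrite geomE // -ltnS.
rewrite mulrC -[1 - u]opprB mulNr -subrX1 opprB.
by rewrite fps_coefD fps_coefN fps_coefX_small // subr0.
Qed.

Lemma fps_coef_constM (k : F) a n : fps_coef (fps_const k * a) n = k * fps_coef a n.
Proof.
rewrite fps_coefM big_ord_recl /= subn0 big1 ?addr0 // => i _.
by rewrite mul0r.
Qed.

Lemma fps_mulVx : {in fps_unit, left_inverse 1 fps_inv *%R}.
Proof.
move=> a a_unit; have a0 : fps_coef a 0 != 0 by [].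
rewrite /fps_inv (negPf a0) -mulrA mulrCA.
set u := 1 - _; suff u0 : fps_coef u 0 = 0.
  by have := fps_geomE u0; rewrite {2}/u opprB addrC subrK.
by rewrite /u fps_coefD fps_coefN fps_coef_constM mulVf ?subrr.
Qed.

Lemma fps_unitPl a b : b * a = 1 -> fps_unit a.
Proof.
move=> /(congr1 (fun c => fps_coef c 0)).
rewrite fps_coefM big_ord1 fps_coef1 /= => ba1; apply/negP => /eqP a0.
by move: ba1 => /eqP; rewrite a0 mulr0 eq_sym oner_eq0.
Qed.

Lemma fps_inv_out : {in [predC fps_unit], fps_inv =1 id}.
Proof. by move=> a /negPn a0; rewrite /fps_inv a0. Qed.

HB.instance Definition _ := GRing.ComNzRing_hasMulInverse.Build (fps F)
  fps_mulVx fps_unitPl fps_inv_out.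

Lemma fps_unitE a : (a \is a GRing.unit) = (fps_coef a 0 != 0).
Proof. by []. Qed.

Definition fps_X : fps F := FPS (fun n => (n == 1)%:R).

End FormalPowerSeries.

Arguments fps_X {F}.

(* ['S_n] permutes {0, ..., n-1}; values are shifted to {1, ..., n}. *)
Definition one_line n (pi : 'S_n) : seq nat := [seq (pi i).+1 | i <- enum 'I_n].

Definition order_isomorphic (s t : seq nat) : bool :=
  (size s == size t) &&
  [forall i : 'I_(size s), forall j : 'I_(size s),
     (nth 0 s i < nth 0 s j)%N == (nth 0 t i < nth 0 t j)%N].

Definition contains (w tau : seq nat) : bool :=
  [exists m : (size w).-tuple bool, order_isomorphic (mask m w) tau].

Lemma containsP (w tau : seq nat) :
  reflect (exists2 s, subseq s w & order_isomorphic s tau) (contains w tau).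
Proof.
apply: (iffP existsP) => [[m iso_m]|[s /subseqP[m size_m ->] iso_m]].
  by exists (mask m w) => //; apply: mask_subseq.
by exists (Tuple (introT eqP size_m)).
Qed.

Definition avoiders (T : seq (seq nat)) n : {set 'S_n} :=
  [set pi : 'S_n | all (fun tau => ~~ contains (one_line pi) tau) T].

Definition avoiders_gf (T : seq (seq nat)) : fps rat :=
  FPS (fun n => #|avoiders T n|%:R).

(* The power series expansion of (1 - sqrt (1 - 4 x)) / (2 x). *)
Definition catalan_gf : fps rat :=
  FPS (fun n => n.+1%:R^-1 * 'C(2 * n, n)%:R).

(* Main.v *)
(* Let N be the largest letter of an avoider w = u N v.  If all letters of u
   exceed all letters of v, then u is any 132-avoider (a 132 in u would be the
   132 of a 1324 ending in N) and v any avoider, which contributes x C F.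

   Otherwise some a in u is less than some c in v; let M be the generating
   function of these avoiders.  If such a word starts with a descent p q then
   p = q + 1, since a letter with value between q and p creates a forbidden
   pattern; deleting p is a bijection onto the same class one size down.  Hence
   M = x M + U, where U counts the words of the class that start with an ascent
   p q.  If q = N, deleting N leaves an arbitrary avoider that does not start
   with its maximum (counted by G); if q <> N, then N - 1 immediately precedes N
   and deleting N stays in the class.  Hence U = x G + x U.

   With F = 1 + x F + G this is a linear system, and C = 1 + x C^2 solves it. *)
Require Import Defs.
From mathcomp Require Import all_boot all_order all_algebra all_fingroup.
From mathcomp Require Import boolp zify ring.

Set Implicit Arguments.
Unset Strict Implicit.
Unset Printing Implicit Defensive.

Import GRing.Theory Num.Theory.

(** * Counting words *)

Definition words n : seq (seq nat) := permutations (iota 1 n).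

Lemma words_uniq n (w : seq nat) : w \in words n -> uniq w.
Proof. by rewrite mem_permutations => /perm_uniq ->; rewrite iota_uniq. Qed.

Lemma words_size n (w : seq nat) : w \in words n -> size w = n.
Proof. by rewrite mem_permutations => /perm_size ->; rewrite size_iota. Qed.

Lemma mem_words n (w : seq nat) (x : nat) : w \in words n -> (x \in w) = (0 < x <= n).
Proof. by rewrite mem_permutations => /perm_mem ->; rewrite mem_iota; lia. Qed.

Lemma index_words n (w : seq nat) (x : nat) : w \in words n -> (index x w < n) = (0 < x <= n).
Proof.
by move=> ww; rewrite -(mem_words x ww) -index_mem (words_size ww).
Qed.

Lemma in_words n (w : seq nat) : uniq w -> size w = n ->
  (forall x, x \in w -> 0 < x <= n) -> w \in words n.
Proof.
move=> uw sw lw; rewrite mem_permutations; apply: uniq_perm => //.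
  exact: iota_uniq.
have sub x : x \in w -> x \in iota 1 n by move/lw; rewrite mem_iota; lia.
have le : size (iota 1 n) <= size w by rewrite size_iota sw.
exact: (uniq_min_size uw sub le).2.
Qed.

Lemma index_inj_words n (w : seq nat) (x y : nat) : w \in words n -> index x w < n ->
  index x w = index y w -> x = y.
Proof.
move=> ww lx e; apply: (index_inj 0 (s := w)) => //;
  by rewrite -index_mem (words_size ww) -?e.
Qed.

(** The properties counted quantify over all natural numbers, hence [Prop] and classical truth
    values. *)
Definition nb n (P : seq nat -> Prop) := count (fun w => `[< P w >]) (words n).

Lemma nbE n P : nb n P = size [seq w <- words n | `[< P w >]].
Proof. by rewrite size_filter. Qed.

Lemma nb_ext n (P Q : seq nat -> Prop) :
  (forall w, w \in words n -> P w <-> Q w) -> nb n P = nb n Q.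
Proof.
move=> PQ; apply: eq_in_count => w /PQ PQw; exact/asbool_equiv_eq.
Qed.

Lemma nb_split n (P Q : seq nat -> Prop) :
  nb n P = nb n (fun w => P w /\ Q w) + nb n (fun w => P w /\ ~ Q w).
Proof.
rewrite /nb -count_predUI [X in _ + X](@eq_count _ _ pred0) ?count_pred0 ?addn0.
  by apply: eq_count => w /=; rewrite !asbool_and asbool_neg -andb_orr orbN andbT.
by move=> w /=; rewrite !asbool_and asbool_neg andbACA andbN andbF.
Qed.

Lemma nb_image n m (f : seq nat -> seq nat) (P Q : seq nat -> Prop) :
    {in words n &, injective f} ->
    (forall w, w \in words n -> P w -> f w \in words m /\ Q (f w)) ->
    (forall w, w \in words m -> Q w ->
       exists v, [/\ v \in words n, P v & w = f v]) ->
  nb n P = nb m Q.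
Proof.
move=> f_inj fP fQ; rewrite !nbE -(size_map f); apply/perm_size/uniq_perm.
- rewrite map_inj_in_uniq ?filter_uniq ?permutations_uniq // => u v.
  by rewrite !mem_filter => /andP[_ uw] /andP[_ vw]; apply: f_inj.
- by rewrite filter_uniq ?permutations_uniq.
move=> w; rewrite mem_filter; apply/mapP/andP => [[v]|[/asboolP Qw ww]].
  by rewrite mem_filter => /andP[/asboolP Pv vw] ->; have [? /asboolP] := fP v vw Pv.
have [v [vw Pv ->]] := fQ w ww Qw.
by exists v => //; rewrite mem_filter vw andbT; apply/asboolP.
Qed.

Lemma nb_sum_index n (P : seq nat -> Prop) :
  nb n.+1 P = \sum_(i < n.+1) nb n.+1 (fun w => P w /\ index n.+1 w = i).
Proof.
have -> : \sum_(i < n.+1) nb n.+1 (fun w => P w /\ index n.+1 w = i) =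
    \sum_(i < n.+1) \sum_(w <- words n.+1 | `[< P w >] && (index n.+1 w == i)) 1.
  apply: eq_bigr => i _; rewrite /nb -sum1_count; apply: eq_bigl => w.
  by rewrite asbool_and; congr (_ && _); apply/asboolP/eqP.
rewrite (exchange_big_dep (fun w => `[< P w >])) /=; last by move=> i w _ /andP[].
rewrite /nb -sum1_count big_seq_cond [RHS]big_seq_cond.
apply: eq_bigr => w /andP[ww ->].
have lt_i : index n.+1 w < n.+1 by rewrite index_words ?leqnn.
rewrite (big_pred1 (Ordinal lt_i)) // => i /=.
by rewrite -val_eqE eq_sym.
Qed.

(** * Pattern avoidance and the skew case *)

(* A letter missing from [w] has index [size w], so the bound on the last index
   makes all the letters occur in [w]. *)
Definition avoids132 (w : seq nat) := forall a b c : nat,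
  index a w < index b w < index c w -> index c w < size w -> ~~ (a < c < b).

(** The disjuncts are, in order, occurrences of 1243, 1324 and 3142 by the letters [a b c d] from
    left to right. *)
Definition avoidsT (w : seq nat) := forall a b c d : nat,
  index a w < index b w < index c w -> index c w < index d w < size w ->
  ~~ [|| [&& a < b, b < d & d < c], [&& a < c, c < b & b < d]
    | [&& b < d, d < a & a < c]].

(** The skew sum of two words: [u] with a new maximum appended, above [v]. *)
Definition skew_max (u v : seq nat) : seq nat :=
  map (addn (size v)) u ++ (size u + size v).+1 :: v.

(** In a word of [words n] the letter [size w] is the maximum, so the predicate need not mention
    [n]. *)
Definition max_skew (w : seq nat) := forall a c : nat,
  index a w < index (size w) w < index c w -> index c w < size w -> c < a.

(** Without repeated letters, a subsequence is determined by its set of letters: it is that set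
    listed by position. *)
Lemma subseq_index (w s : seq nat) : uniq w ->
  subseq s w = all (mem w) s && sorted (relpre (index^~ w) ltn) s.
Proof.
move=> uw; have tr : transitive (relpre (index^~ w) ltn).
  by move=> x y z /=; apply: ltn_trans.
have sw : sorted (relpre (index^~ w) ltn) w.
  by apply/(sortedP 0) => k lt_k /=; rewrite !index_uniq // ltnW.
apply/idP/andP => [sub|[/allP sub srt]].
  by split; [apply/allP => x; apply: mem_subseq | apply: subseq_sorted sub sw].
(* Both [s] and the filtered [w] are strictly sorted by position with the same members, hence
   equal. *)
apply/subseq_uniqP => //; apply: (irr_sorted_eq tr) => //.
- by move=> x /=; rewrite ltnn.
- exact: sorted_filter.
by move=> x; rewrite mem_filter andb_idr // => /sub.
Qed.

Lemma order_isomorphicP (s t : seq nat) :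
  reflect (size s = size t /\ forall i j, i < size s -> j < size s ->
             (nth 0 s i < nth 0 s j) = (nth 0 t i < nth 0 t j))
          (order_isomorphic s t).
Proof.
apply: (iffP andP) => [[/eqP sz /forallP iso]|[-> iso]].
  split=> // i j lt_i lt_j.
  by have /forallP/(_ (Ordinal lt_j))/eqP := iso (Ordinal lt_i).
split=> //; apply/forallP => i; apply/forallP => j; rewrite iso //.
Qed.

(** Comparing the positions that are consecutive in value already fixes every other comparison; the
    next two lemmas use the same scheme. *)
Lemma order_isomorphic1243 (a b c d : nat) :
  order_isomorphic [:: a; b; c; d] [:: 1; 2; 4; 3] = [&& a < b, b < d & d < c].
Proof.
apply/order_isomorphicP/idP => [[_ iso]|abc].
  have := iso 0 1 isT isT; have := iso 1 3 isT isT; have := iso 3 2 isT isT.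
  by rewrite /=; lia.
by split=> // -[|[|[|[|]]]] // [|[|[|[|]]]] //= _ _; lia.
Qed.

Lemma order_isomorphic1324 (a b c d : nat) :
  order_isomorphic [:: a; b; c; d] [:: 1; 3; 2; 4] = [&& a < c, c < b & b < d].
Proof.
apply/order_isomorphicP/idP => [[_ iso]|abc].
  have := iso 0 2 isT isT; have := iso 2 1 isT isT; have := iso 1 3 isT isT.
  by rewrite /=; lia.
by split=> // -[|[|[|[|]]]] // [|[|[|[|]]]] //= _ _; lia.
Qed.

Lemma order_isomorphic3142 (a b c d : nat) :
  order_isomorphic [:: a; b; c; d] [:: 3; 1; 4; 2] = [&& b < d, d < a & a < c].
Proof.
apply/order_isomorphicP/idP => [[_ iso]|abc].
  have := iso 1 3 isT isT; have := iso 3 0 isT isT; have := iso 0 2 isT isT.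
  by rewrite /=; lia.
by split=> // -[|[|[|[|]]]] // [|[|[|[|]]]] //= _ _; lia.
Qed.

Lemma contains4P (w : seq nat) (i j k l : nat) (t := [:: i; j; k; l]) :
    uniq w ->
  contains w t <-> exists a b c d : nat,
    [/\ index a w < index b w < index c w, index c w < index d w < size w
      & order_isomorphic [:: a; b; c; d] t].
Proof.
move=> uw; split=> [/containsP[s]|[a [b [c [d [lt_abc lt_cd iso]]]]]].
  rewrite (subseq_index _ uw) => sub iso; have [sz _] := order_isomorphicP _ _ iso.
  case: s sz sub iso => [|a [|b [|c [|d [|]]]]] // _ sub iso.
  exists a, b, c, d; move: sub; rewrite /= -!index_mem.
  by case/andP=> /and5P[_ _ _ -> _] /and4P[-> -> -> _].
case/andP: lt_abc => ab bc; case/andP: lt_cd => cd dw.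
have [cw bw] := (ltn_trans cd dw, ltn_trans bc (ltn_trans cd dw)).
apply/containsP; exists [:: a; b; c; d] => //.
by rewrite (subseq_index _ uw) /= -!index_mem ab bc cd dw cw bw (ltn_trans ab bw).
Qed.

(** Bridge from the containment test of the statement to the positional form used in all the
    combinatorics. *)
Lemma avoidsTP (w : seq nat) : uniq w ->
  reflect (avoidsT w)
    (all (fun tau => ~~ contains w tau)
       [:: [:: 1; 2; 4; 3]; [:: 1; 3; 2; 4]; [:: 3; 1; 4; 2]]).
Proof.
move=> uw; apply: (iffP idP) => [/and4P[n1 n2 n3 _] a b c d lt_abc lt_cd|av].
  apply/negP => pat; move: pat n1 n2 n3.
  rewrite -order_isomorphic1243 -order_isomorphic1324 -order_isomorphic3142.
  by case/or3P=> iso; [move/negP=> + _ _|move=> _ /negP + _|move=> _ _ /negP]; apply;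
    apply/contains4P => //; exists a, b, c, d.
by apply/and4P; split=> //; apply/negP;
  move=> /(contains4P _ _ _ _ uw)[a [b [c [d [lt_abc lt_cd]]]]];
  have := av a b c d lt_abc lt_cd;
  rewrite ?(order_isomorphic1243, order_isomorphic1324, order_isomorphic3142) => /negP + iso;
  apply; rewrite iso ?orbT.
Qed.

(** * Decomposition of a skew word at its maximum *)

Lemma skew_max_words i j (u v : seq nat) : u \in words i -> v \in words j ->
  skew_max u v \in words (i + j).+1.
Proof.
move=> uw vw; rewrite /skew_max (words_size uw) (words_size vw).
apply: in_words.
- rewrite cat_uniq /= map_inj_uniq ?(words_uniq uw) ?(words_uniq vw) //; last exact: addnI.
  rewrite andbT negb_or -!andbA (mem_words _ vw); apply/and4P; split=> //.
  + by apply/mapP => -[x]; rewrite (mem_words _ uw); lia.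
  + apply/hasPn => x; rewrite (mem_words _ vw) => xv.
    by apply/mapP => -[y]; rewrite (mem_words _ uw); lia.
  + by lia.
- by rewrite size_cat size_map /= (words_size uw) (words_size vw); lia.
move=> x; rewrite mem_cat inE (mem_words _ vw) => /orP[/mapP[y]|].
  by rewrite (mem_words _ uw); lia.
by lia.
Qed.

(** The last branch also covers absent letters: their index in [v] is [j], which yields the size of
    the whole word. *)
Lemma index_skew_max i j (u v : seq nat) (x : nat) : u \in words i -> v \in words j ->
  index x (skew_max u v) =
  if j < x <= i + j then index (x - j) u
  else if x == (i + j).+1 then i else (i + index x v).+1.
Proof.
move=> uw vw; rewrite /skew_max index_cat size_map (words_size uw) (words_size vw).
have -> : (x \in map (addn j) u) = (j < x <= i + j).
  apply/mapP/idP => [[y]|xij]; first by rewrite (mem_words _ uw); lia.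
  by exists (x - j); [rewrite (mem_words _ uw); lia | lia].
case: ifP => xij; last by rewrite /= eq_sym; case: eqP => _; lia.
by rewrite -[X in index X _](@subnKC j) ?index_map //; [exact: addnI | lia].
Qed.

Lemma max_skew_skew_max i j (u v : seq nat) :
  u \in words i -> v \in words j -> max_skew (skew_max u v).
Proof.
move=> uw vw a c; have ww := skew_max_words uw vw.
rewrite (words_size ww) !(index_skew_max _ uw vw).
have := index_words (a - j) uw; have := index_words (c - j) uw.
have := index_words c vw.
by do ![case: ifP => ?]; lia.
Qed.

(** Cut at the maximum: the letters after it are all smaller than those before it, so they form an
    initial interval of values, and shifting the prefix down gives [u]. *)
Lemma max_skewP n (w : seq nat) : w \in words n.+1 -> max_skew w ->
  exists u v : seq nat, [/\ u \in words (index n.+1 w),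
    v \in words (n - index n.+1 w) & w = skew_max u v].
Proof.
move=> ww; have uw := words_uniq ww; have sw := words_size ww.
have n1w : n.+1 \in w by rewrite (mem_words _ ww) leqnn.
rewrite /max_skew sw; move: ww uw sw.
case/splitPr: n1w => p q ww; rewrite cat_uniq /= negb_or.
case/and3P=> up /andP[np npq] /andP[nq uq].
rewrite size_cat /= addnS => -[sz]; subst n; set n := size p + size q in ww np nq *.
move=> sk.
have ip : index n.+1 (p ++ n.+1 :: q) = size p.
  by rewrite index_cat (negPf np) /= eqxx addn0.
rewrite ip addKn in sk *.
have qp a c : a \in p -> c \in q -> c < a.
  move=> ap cq; have ci : index c (p ++ n.+1 :: q) = (size p + index c q).+1.
    rewrite index_cat /=.
    have /negPf -> : c \notin p by apply: contra npq => cp; apply/hasP; exists c.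
    have /negPf -> : n.+1 != c by apply: contra nq => /eqP ->.
    by rewrite addnS.
  apply: sk; rewrite ci ?size_cat /= ?addnS ?ltnS ?ltn_add2l ?index_mem //.
  by rewrite index_cat ap index_mem ap leq_addr.
have perm_qp : perm_eq (q ++ p) (iota 1 n).
  move: ww; rewrite mem_permutations perm_catC -[X in iota 1 X]addn1 iotaD /= add1n.
  by rewrite perm_sym perm_catC /= perm_cons perm_sym.
(* Since [q] lies below [p], this concatenation is sorted; comparing it with [iota 1 n] block by
   block identifies the letters of each part. *)
have : sort leq q ++ sort leq p = iota 1 n.
  apply: (sorted_eq leq_trans anti_leq).
  - rewrite (sorted_pairwise leq_trans) pairwise_cat -!(sorted_pairwise leq_trans).
    rewrite !(sort_sorted leq_total) !andbT; apply/allrelP => c a.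
    by rewrite !mem_sort => cq ap; apply/ltnW/qp.
  - exact: iota_sorted.
  - by apply: perm_trans perm_qp; apply: perm_cat; rewrite perm_sort.
rewrite /n addnC iotaD => /eqP; rewrite eqseq_cat ?size_sort ?size_iota //.
case/andP=> /eqP eq_q /eqP eq_p.
have qw : q \in words (size q) by rewrite mem_permutations -eq_q perm_sym perm_sort.
have : perm_eq p (map (addn (size q)) (iota 1 (size p))).
  by rewrite -iotaDl addnC -eq_p perm_sym perm_sort.
set u := map (subn^~ (size q)) p.
have def_p : p = map (addn (size q)) u.
  rewrite -map_comp -[LHS]map_id; apply/eq_in_map => x.
  by rewrite -(mem_sort leq) eq_p mem_iota /=; lia.
rewrite {1}def_p => /(perm_map_inj (@addnI _)) => pu.
exists u, q; rewrite mem_permutations pu qw; split=> //.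
by rewrite /skew_max -def_p size_map /n addnC.
Qed.

(** A property that splits along [skew_max] is counted by a convolution: [i] is the position of the
    maximum, and [u] and [v] are chosen independently. *)
Lemma nb_skew_max n (P P1 P2 : seq nat -> Prop) :
    (forall i j (u v : seq nat), u \in words i -> v \in words j ->
       P (skew_max u v) <-> P1 u /\ P2 v) ->
  nb n.+1 (fun w => P w /\ max_skew w) = \sum_(i < n.+1) nb i P1 * nb (n - i) P2.
Proof.
move=> PE; rewrite nb_sum_index; apply: eq_bigr => -[i le_in] _ /=; rewrite ltnS in le_in.
rewrite !nbE -(size_allpairs skew_max).
have fst_words : forall x, x \in [seq w <- words i | `[< P1 w >]] -> x \in words i.
  by move=> x; rewrite mem_filter => /andP[].
have snd_words : forall x, x \in [seq w <- words (n - i) | `[< P2 w >]] -> x \in words (n - i).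
  by move=> x; rewrite mem_filter => /andP[].
apply/perm_size/uniq_perm.
- by rewrite filter_uniq ?permutations_uniq.
- apply: allpairs_uniq; rewrite ?filter_uniq ?permutations_uniq //.
  move=> x y /allpairsP[[u v] [/= /fst_words uw /snd_words vw ->]].
  move=> /allpairsP[[u' v'] [/= /fst_words uw' /snd_words vw' ->]] /eqP.
  rewrite /= /skew_max (words_size uw) (words_size vw) (words_size uw') (words_size vw').
  rewrite eqseq_cat ?size_map ?(words_size uw) ?(words_size uw') // eqseq_cons eqxx /=.
  by case/andP=> /eqP/(inj_map (@addnI _)) -> /eqP ->.
move=> w; rewrite mem_filter; apply/andP/allpairsP.
  case=> /asboolP[[Pw sw] iw] ww; have [] := max_skewP ww sw => u [v []].
  rewrite iw => uw vw def_w; exists (u, v); split=> //=;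
    rewrite mem_filter ?uw ?vw andbT; apply/asboolP;
    by have := (PE _ _ _ _ uw vw).1; rewrite -def_w; case.
case=> -[u v] [/=]; rewrite !mem_filter => /andP[/asboolP P1u uw] /andP[/asboolP P2v vw] ->.
have ww := skew_max_words uw vw; rewrite subnKC // in ww.
have iw : index n.+1 (skew_max u v) = i.
  by rewrite (index_skew_max _ uw vw) subnKC ?ltnn ?andbF ?eqxx.
split=> //; apply/asboolP; split=> //; split; first exact/(PE _ _ _ _ uw vw).
exact: max_skew_skew_max uw vw.
Qed.

(** Ties the block of a letter to its position, so that the avoidance lemmas below become linear
    arithmetic. *)
Lemma skew_max_cases i j (u v : seq nat) (x : nat) :
    u \in words i -> v \in words j -> index x (skew_max u v) < (i + j).+1 ->
  [\/ [/\ j < x <= i + j, index (x - j) u < i &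
          index x (skew_max u v) = index (x - j) u],
      x = (i + j).+1 /\ index x (skew_max u v) = i
    | [/\ 0 < x <= j, index x v < j &
          index x (skew_max u v) = (i + index x v).+1]].
Proof.
move=> uw vw; rewrite (index_words _ (skew_max_words uw vw)) (index_skew_max _ uw vw).
have := index_words (x - j) uw; have := index_words x vw.
case: ifP => [xij _ lt_u _|xij lt_v _]; first by constructor 1; split=> //; lia.
case: eqP => [x_max _|x_max x_le]; first by constructor 2.
by constructor 3; split=> //; lia.
Qed.

Lemma index_skew_max_left i j (u v : seq nat) (x : nat) :
    u \in words i -> v \in words j -> index x u < i ->
  index (j + x) (skew_max u v) = index x u.
Proof.
move=> uw vw; rewrite (index_words _ uw) (index_skew_max _ uw vw) addKn => lt_x.
by case: ifP; lia.
Qed.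

Lemma index_skew_max_right i j (u v : seq nat) (x : nat) :
    u \in words i -> v \in words j -> index x v < j ->
  index x (skew_max u v) = (i + index x v).+1.
Proof.
move=> uw vw lt_x; have := index_words x vw; rewrite lt_x (index_skew_max _ uw vw).
by case: ifP; first lia; case: eqP; lia.
Qed.

Lemma index_max_skew_max i j (u v : seq nat) :
  u \in words i -> v \in words j -> index (i + j).+1 (skew_max u v) = i.
Proof. by move=> uw vw; rewrite (index_skew_max _ uw vw) ltnn andbF eqxx. Qed.

(** If the 1 of a 132 lies in [u], the larger 2 cannot lie in [v], and then all three letters are in
    [u]; the maximum cannot be the 1, and a 1 in [v] forces everything into [v]. *)
Lemma avoids132_skew_max i j (u v : seq nat) : u \in words i -> v \in words j ->
  avoids132 (skew_max u v) <-> avoids132 u /\ avoids132 v.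
Proof.
move=> uw vw; have sw := words_size (skew_max_words uw vw).
have su := words_size uw; have sv := words_size vw.
split=> [av|[avu avv] a b c]; last first.
  rewrite sw => /andP[ab bc] lc.
  have lb := ltn_trans bc lc; have la := ltn_trans ab lb.
  have := avu (a - j) (b - j) (c - j); have := avv a b c; rewrite su sv.
  case: (skew_max_cases uw vw la) => [[? ? ?]|[? ?]|[? ? ?]];
  case: (skew_max_cases uw vw lb) => [[? ? ?]|[? ?]|[? ? ?]];
  case: (skew_max_cases uw vw lc) => [[? ? ?]|[? ?]|[? ? ?]];
  lia.
split=> a b c lt_abc lt_c.
  have := av (j + a) (j + b) (j + c).
  by rewrite sw !(index_skew_max_left uw vw); lia.
have := av a b c.
by rewrite sw !(index_skew_max_right uw vw); lia.
Qed.

(** A forbidden pattern starting in [u] has three of its letters forming a 132 inside [u]; any other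
    one lies within [v]. Conversely, a 132 in [u] followed by the maximum is a 1324. *)
Lemma avoidsT_skew_max i j (u v : seq nat) : u \in words i -> v \in words j ->
  avoidsT (skew_max u v) <-> avoids132 u /\ avoidsT v.
Proof.
move=> uw vw; have sw := words_size (skew_max_words uw vw).
have su := words_size uw; have sv := words_size vw.
split=> [av|[avu avv] a b c d]; last first.
  rewrite sw => /andP[ab bc] /andP[cd ld].
  have lc := ltn_trans cd ld; have lb := ltn_trans bc lc; have la := ltn_trans ab lb.
  have acd := avu (a - j) (c - j) (d - j); have abc := avu (a - j) (b - j) (c - j).
  have bcd := avu (b - j) (c - j) (d - j); have abcd := avv a b c d.
  rewrite su sv in acd abc bcd abcd; apply/negP => /or3P pat.
  case: (skew_max_cases uw vw la) => [[? ? ia]|[? ia]|[? ? ia]];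
  case: (skew_max_cases uw vw lb) => [[? ? ib]|[? ib]|[? ? ib]];
    try (by clear -ab ia ib; lia);
  case: (skew_max_cases uw vw lc) => [[? ? ic]|[? ic]|[? ? ic]];
    try (by clear -bc ib ic; lia);
  case: (skew_max_cases uw vw ld) => [[? ? id]|[? id]|[? ? id]];
    try (by clear -cd ic id; lia);
  case: pat => pat; try (by clear abc acd bcd abcd; lia);
  (* Each remaining placement is refuted by a single hypothesis: a 132 in [u] on one of three
     triples, or the full pattern in [v]. *)
  first [by clear acd bcd abcd; lia | by clear abc bcd abcd; lia
    | by clear abc acd abcd; lia | by clear abc acd bcd; lia].
split=> [a b c lt_abc lt_c|a b c d lt_abc lt_cd].
  (* The maximum of the whole word plays the 4 of a 1324. *)
  have := av (j + a) (j + b) (j + c) (i + j).+1; have := index_words b uw.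
  by rewrite sw (index_max_skew_max uw vw) !(index_skew_max_left uw vw); lia.
have := av a b c d.
by rewrite sw !(index_skew_max_right uw vw); lia.
Qed.

(** Letters [a < c] on the two sides of the maximum would form a 132 with it. *)
Lemma avoids132_max_skew n (w : seq nat) : w \in words n -> avoids132 w -> max_skew w.
Proof.
move=> ww av a c; have := av a (size w) c; rewrite (words_size ww) => avw lt_anc lt_c.
have := index_words n ww; have := index_words c ww.
have : a <> c by move=> ac; move: lt_anc; rewrite ac; lia.
have : c <> n by move=> cn; move: lt_anc; rewrite cn; lia.
by lia.
Qed.

(** Every 132-avoider falls in the skew case, so the convolution is the Catalan recurrence. *)
Lemma nb132_rec n : nb n.+1 avoids132 =
  \sum_(i < n.+1) nb i avoids132 * nb (n - i) avoids132.
Proof.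
rewrite -(nb_skew_max n avoids132_skew_max).
by apply: nb_ext => w ww; split=> [av|[]//]; split; last exact: avoids132_max_skew ww av.
Qed.

Lemma nbT_split n : nb n.+1 avoidsT =
  \sum_(i < n.+1) nb i avoids132 * nb (n - i) avoidsT
  + nb n.+1 (fun w => avoidsT w /\ ~ max_skew w).
Proof.
rewrite (nb_split _ _ max_skew); congr (_ + _).
exact: (nb_skew_max n avoidsT_skew_max).
Qed.

(** * Insertion of a new maximum *)

Definition insert_max i (w : seq nat) : seq nat := take i w ++ (size w).+1 :: drop i w.

Lemma insert_max_words n i (w : seq nat) :
  w \in words n -> insert_max i w \in words n.+1.
Proof.
move=> ww; rewrite /insert_max (words_size ww) mem_permutations perm_sym.
rewrite -[X in iota 1 X]addn1 iotaD add1n perm_catC perm_sym.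
rewrite perm_catC /= perm_cons perm_catC cat_take_drop.
by move: ww; rewrite mem_permutations.
Qed.

(** Filtering out the maximum recovers the word, whatever the place of insertion. *)
Lemma insert_max_inj n i j (v w : seq nat) : v \in words n -> w \in words n ->
  insert_max i v = insert_max j w -> v = w.
Proof.
have filt k (u : seq nat) : u \in words n ->
    [seq x <- insert_max k u | x != n.+1] = u.
  move=> uw; rewrite /insert_max (words_size uw) filter_cat /= eqxx /=.
  rewrite -filter_cat cat_take_drop; apply/all_filterP/allP => x.
  by rewrite (mem_words _ uw); lia.
by move=> vw ww e; rewrite -(filt i v vw) -(filt j w ww) e.
Qed.

Lemma insert_max_surj n (w : seq nat) : w \in words n.+1 ->
  exists2 v, v \in words n & w = insert_max (index n.+1 w) v.
Proof.
move=> ww; have uw := words_uniq ww; have sw := words_size ww.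
have n1w : n.+1 \in w by rewrite (mem_words _ ww) leqnn.
move: ww uw sw; case/splitPr: n1w => p q ww; rewrite cat_uniq /= negb_or.
case/and3P=> up /andP[np npq] /andP[nq uq]; rewrite size_cat /= addnS => -[sz].
exists (p ++ q); last first.
  rewrite /insert_max index_cat (negPf np) /= eqxx addn0 size_cat sz.
  by rewrite take_size_cat // drop_size_cat.
rewrite mem_permutations perm_catC; move: ww; rewrite mem_permutations perm_catC.
rewrite -[X in iota 1 X]addn1 iotaD /= add1n.
by rewrite perm_sym perm_catC /= perm_cons perm_sym.
Qed.

Lemma index_insert_max_new n i (w : seq nat) : w \in words n -> i <= n ->
  index n.+1 (insert_max i w) = i.
Proof.
move=> ww le_i; rewrite /insert_max index_cat (words_size ww).
have /negPf -> : n.+1 \notin take i w.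
  by apply/negP => /mem_take; rewrite (mem_words _ ww); lia.
by rewrite /= eqxx addn0 size_takel ?(words_size ww).
Qed.

Lemma index_insert_max n i (w : seq nat) (x : nat) : w \in words n -> i <= n ->
  x <= n -> index x (insert_max i w) = index x w + (i <= index x w).
Proof.
move=> ww le_i le_x; rewrite /insert_max index_cat (words_size ww).
have st : size (take i w) = i by rewrite size_takel ?(words_size ww).
rewrite -[in RHS](cat_take_drop i w) index_cat st /=.
have -> : (n.+1 == x) = false by lia.
by case: ifP => [|_]; [rewrite -index_mem st | ]; lia.
Qed.

Lemma insert_max_cases n i (w : seq nat) (x : nat) : w \in words n -> i <= n ->
    index x (insert_max i w) < n.+1 ->
  (x = n.+1 /\ index x (insert_max i w) = i) \/
  [/\ 0 < x <= n, index x w < n &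
      index x (insert_max i w) = index x w + (i <= index x w)].
Proof.
move=> ww le_i; rewrite (index_words _ (insert_max_words i ww)) => x_le.
have [->|/eqP x_n] := eqVneq x n.+1.
  by left; rewrite (index_insert_max_new ww le_i).
right; have le_x : 0 < x <= n by lia.
by split=> //; rewrite ?(index_words _ ww) ?(index_insert_max ww le_i) //; lia.
Qed.

Lemma avoidsT_of_insert_max n i (w : seq nat) : w \in words n -> i <= n ->
  avoidsT (insert_max i w) -> avoidsT w.
Proof.
move=> ww le_i av a b c d; have := av a b c d.
rewrite (words_size ww) (words_size (insert_max_words i ww)) => avw abc cd.
have := index_words a ww; have := index_words b ww.
have := index_words c ww; have := index_words d ww.
move=> wd wc wb wa.
by rewrite !(index_insert_max ww le_i) in avw; lia.
Qed.

(** The maximum can only play the 4, which is third or fourth in each of the patterns; a letter at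
    index 0 or 1 has too few letters before it. *)
Lemma avoidsT_insert_max_le1 n i (w : seq nat) : w \in words n -> i <= n -> i <= 1 ->
  avoidsT w -> avoidsT (insert_max i w).
Proof.
move=> ww le_i i1 av a b c d; have := av a b c d.
rewrite (words_size ww) (words_size (insert_max_words i ww)) => avw /andP[ab bc] /andP[cd ld].
have lc := ltn_trans cd ld; have lb := ltn_trans bc lc; have la := ltn_trans ab lb.
apply/negP => /or3P pat.
case: (insert_max_cases ww le_i la) => [[? ia]|[? ? ia]];
case: (insert_max_cases ww le_i lb) => [[? ib]|[? ? ib]];
case: (insert_max_cases ww le_i lc) => [[? ic]|[? ? ic]];
case: (insert_max_cases ww le_i ld) => [[? id]|[? ? id]];
  try (by clear avw; lia); case: pat => pat; lia.
Qed.

(* The map [minn _ n] undoes the insertion: it sends both [n] and [n.+1] to [n]. *)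
Lemma index_insert_max_twin n (w : seq nat) (x y : nat) (i := index n w) :
    0 < n -> w \in words n -> index y (insert_max i.+1 w) < n.+1 ->
    index x (insert_max i.+1 w) < index y (insert_max i.+1 w) ->
    ~ (x = n /\ y = n.+1) ->
  index (minn x n) w < index (minn y n) w < n.
Proof.
move=> n0 ww lt_y lt_xy ne_xy.
have lt_i : i < n by rewrite (index_words _ ww) n0 leqnn.
case: (insert_max_cases ww lt_i (ltn_trans lt_xy lt_y)) => [[ex ix]|[le_x lt_x ix]];
case: (insert_max_cases ww lt_i lt_y) => [[ey iy]|[le_y lt_yw iy]];
  move: lt_xy; rewrite ix iy => lt_xy.
- by rewrite ltnn in lt_xy.
- have -> : minn x n = n by lia.
  have -> : minn y n = y by lia.
  by rewrite lt_yw andbT -/i; lia.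
- have -> : minn x n = x by lia.
  have -> : minn y n = n by lia.
  have : index x w != i.
    by apply/eqP => /(index_inj_words ww lt_x) xn; apply: ne_xy.
  by rewrite -/i lt_i andbT; lia.
have -> : minn x n = x by lia.
have -> : minn y n = y by lia.
by rewrite lt_yw andbT; lia.
Qed.

(** An occurrence using both [n] and [n.+1], which are adjacent in position, would need a 3
    immediately followed by a 4; no forbidden pattern has that. An occurrence using at most one of
    them collapses to an occurrence in [w]. *)
Lemma avoidsT_insert_max_twin n (w : seq nat) : 0 < n -> w \in words n ->
  avoidsT w -> avoidsT (insert_max (index n w).+1 w).
Proof.
move=> n0 ww av a b c d; have w'w := insert_max_words (index n w).+1 ww.
rewrite (words_size w'w) => /andP[ab bc] /andP[cd ld].
have lc := ltn_trans cd ld; have lb := ltn_trans bc lc.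
have le_c : c <= n.+1 by have := index_words c w'w; rewrite lc; lia.
have le_d : d <= n.+1 by have := index_words d w'w; rewrite ld; lia.
apply/negP => /or3P pat.
have /andP[mab _] : index (minn a n) w < index (minn b n) w < n.
  by apply: index_insert_max_twin lb ab _ => //; case: pat; clear -le_c le_d; lia.
have /andP[mbc _] : index (minn b n) w < index (minn c n) w < n.
  by apply: index_insert_max_twin lc bc _ => //; case: pat; clear -le_c le_d; lia.
have /andP[mcd md] : index (minn c n) w < index (minn d n) w < n.
  by apply: index_insert_max_twin ld cd _ => //; case: pat; clear -le_c le_d; lia.
have := av (minn a n) (minn b n) (minn c n) (minn d n).
rewrite (words_size ww) mab mbc mcd md => /(_ isT isT).
have lt_i : index n w < n by rewrite (index_words _ ww) n0 leqnn.
have iN := index_insert_max_new ww lt_i.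
have in' : index n (insert_max (index n w).+1 w) = index n w.
  by rewrite (index_insert_max ww lt_i) // ltnn addn0.
(* The letters playing 3 and 4 are not [n] and [n.+1]: in 1243 they come in the opposite order, in
   3142 and 1324 another letter separates them. *)
have dc : ~ (d = n /\ c = n.+1) by move=> [dn cn]; move: cd; rewrite dn cn iN in'; lia.
have ac : ~ (a = n /\ c = n.+1).
  by move=> [an cn]; move: ab bc; rewrite an cn iN in'; lia.
have bd : ~ (b = n /\ d = n.+1).
  by move=> [bn dn]; move: bc cd; rewrite bn dn iN in'; lia.
by case: pat => pat; clear -pat le_c le_d dc ac bd; lia.
Qed.

(** * Words with a rise across the maximum *)

Lemma not_max_skewP n (w : seq nat) : w \in words n ->
  ~ max_skew w <-> exists a c : nat,
    [/\ index a w < index n w < index c w, index c w < n & a < c].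
Proof.
move=> ww; rewrite /max_skew (words_size ww); split=> [/existsNP[a /existsNP[c]]|].
  move=> /not_implyP[lt_anc /not_implyP[lt_c ac]]; exists a, c; split=> //.
  have : a <> c by move=> e; move: lt_anc; rewrite e; lia.
  by move=> e; move: ac; lia.
by move=> [a [c [lt_anc lt_c ac]]] /(_ a c lt_anc lt_c); lia.
Qed.

Definition starts_up (w : seq nat) := exists p q : nat,
  [/\ index p w = 0, index q w = 1, 1 < size w & p < q].

(** A leading maximum takes part in no forbidden pattern, so it can be inserted and deleted
    freely. *)
Lemma nbT_max_first n : nb n.+1 avoidsT =
  nb n.+1 (fun w => avoidsT w /\ 0 < index (size w) w) + nb n avoidsT.
Proof.
rewrite (nb_split _ _ (fun w => 0 < index (size w) w)); congr (_ + _).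
apply/esym/(nb_image (f := insert_max 0)) => [v w|w ww av|w ww [av]].
- exact: insert_max_inj.
- have w'w := insert_max_words 0 ww; split=> //; split.
    exact: (avoidsT_insert_max_le1 ww).
  by rewrite (words_size w'w) (index_insert_max_new ww).
rewrite (words_size ww) => /negP; rewrite -eqn0Ngt => /eqP i0.
have [v vw def_w] := insert_max_surj ww; rewrite i0 in def_w.
by exists v; split=> //; apply: (avoidsT_of_insert_max vw (leq0n n)); rewrite -def_w.
Qed.

(** Inverse of deleting the first letter of a descent [p.+1], [p]: the head [p] is kept and the
    larger letters are raised by one. *)
Definition dup_first (w : seq nat) : seq nat :=
  (head 0 w).+1 :: map (bump (head 0 w).+1) w.

Lemma dup_first_inj : injective dup_first.
Proof. by move=> v w [-> /inj_map]; apply; apply: can_inj (bumpK _). Qed.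

Lemma dup_first_words n (w : seq nat) : 0 < n -> w \in words n ->
  dup_first w \in words n.+1.
Proof.
move=> n0 ww; have pw : 0 < head 0 w <= n.
  rewrite -(mem_words _ ww); case: w ww => [/words_size|x w _] /=; first by lia.
  by rewrite mem_head.
apply: in_words => [||x].
- rewrite /= (map_inj_uniq (can_inj (bumpK _))) (words_uniq ww) andbT.
  by apply/mapP => -[x _]; apply/eqP/neq_bump.
- by rewrite /= size_map (words_size ww).
rewrite inE => /orP[/eqP ->|/mapP[y]]; first by lia.
by rewrite (mem_words _ ww) /bump; lia.
Qed.

Lemma index_dup_first (w : seq nat) (x : nat) :
  index (bump (head 0 w).+1 x) (dup_first w) = (index x w).+1.
Proof.
rewrite /dup_first /= (negPf (neq_bump _ _)) index_map //.
exact: can_inj (bumpK _).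
Qed.

Lemma index_dup_first_old (w : seq nat) (x : nat) : x != (head 0 w).+1 ->
  index x (dup_first w) = (index (x - (head 0 w < x)) w).+1.
Proof.
by move=> xp; rewrite -index_dup_first; congr index; rewrite /bump; lia.
Qed.

Lemma index_head (w : seq nat) : index (head 0 w) w = 0.
Proof. by case: w => //= x w; rewrite eqxx. Qed.

(* The map [x |-> x - (p < x)] undoes the duplication: it sends both [p] and
   [p.+1] to [p]. *)
Lemma index_dup_first_twin n (w : seq nat) (x y : nat) (p := head 0 w) :
    w \in words n -> index y (dup_first w) < n.+1 ->
    index x (dup_first w) < index y (dup_first w) ->
    ~ (x = p.+1 /\ y = p) ->
  index (x - (p < x)) w < index (y - (p < y)) w < n.
Proof.
move=> ww lt_y lt_xy ne_xy.
have y_p : y != p.+1 by apply/eqP => e; move: lt_xy; rewrite e /= eqxx.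
have iy := index_dup_first_old y_p; rewrite iy ltnS in lt_y lt_xy.
rewrite lt_y andbT; have [e|x_p] := eqVneq x p.+1; last first.
  by move: lt_xy; rewrite (index_dup_first_old x_p).
rewrite e ltnSn subn1 /= index_head lt0n; apply/eqP => iy0.
have := index_inj_words ww lt_y; rewrite iy0 => /(_ p).
by rewrite index_head => /(_ erefl) yp; apply: ne_xy; lia.
Qed.

(** An occurrence using both [p.+1] and [p] would start with a descent of consecutive values, but
    1243 and 1324 start with an ascent, and in 3142 the 2 lies between 1 and 3. Any other occurrence
    collapses to one in [w]. *)
Lemma avoidsT_dup_first n (w : seq nat) : 0 < n -> w \in words n ->
  avoidsT (dup_first w) <-> avoidsT w.
Proof.
move=> n0 ww; have w'w := dup_first_words n0 ww; split=> av a b c d.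
  have := av (bump (head 0 w).+1 a) (bump (head 0 w).+1 b)
             (bump (head 0 w).+1 c) (bump (head 0 w).+1 d).
  rewrite !index_dup_first (words_size w'w) (words_size ww) !ltnS.
  by move=> {}av abc cd; move: (av abc cd); clear; rewrite /bump; lia.
rewrite (words_size w'w) => /andP[ab bc] /andP[cd ld].
have lc := ltn_trans cd ld; have lb := ltn_trans bc lc.
set p := head 0 w.
have ip1 : index p.+1 (dup_first w) = 0 by rewrite /= eqxx.
have ip : index p (dup_first w) = 1.
  by rewrite index_dup_first_old ?ltnn ?subn0 ?index_head // -/p; lia.
have bp : b <> p.+1 by move=> e; move: ab; rewrite e ip1.
have cp : c <> p.+1 by move=> e; move: bc; rewrite e ip1.
have dp : d <> p.+1 by move=> e; move: cd; rewrite e ip1.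
(* Rules out [d] and [a] being [p] and [p.+1] in a 3142: three letters precede [d], but only one
   precedes [p]. *)
have dp' : d <> p by move=> e; move: ab bc cd; rewrite e ip; lia.
apply/negP => /or3P pat.
have /andP[mab _] : index (a - (p < a)) w < index (b - (p < b)) w < n.
  by apply: index_dup_first_twin lb ab _ => // -[]; clear -pat dp; case: pat; lia.
have /andP[mbc _] : index (b - (p < b)) w < index (c - (p < c)) w < n.
  by apply: index_dup_first_twin lc bc _ => // -[].
have /andP[mcd md] : index (c - (p < c)) w < index (d - (p < d)) w < n.
  by apply: index_dup_first_twin ld cd _ => // -[].
have := av (a - (p < a)) (b - (p < b)) (c - (p < c)) (d - (p < d)).
rewrite (words_size ww) mab mbc mcd md => /(_ isT isT).
have mono x y : x < y -> ~ (x = p /\ y = p.+1) -> x - (p < x) < y - (p < y).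
  by clear; lia.
by case: pat => /and3P[h1 h2 h3]; rewrite (mono _ _ h1) ?(mono _ _ h2) ?(mono _ _ h3)
  ?orbT //= => -[]; clear -h1 h2 h3 bp cp dp dp'; lia.
Qed.

Lemma not_starts_up_first2 n (w : seq nat) : w \in words n -> 1 < n -> ~ starts_up w ->
  exists p q : nat, [/\ index p w = 0, index q w = 1 & q < p].
Proof.
move=> ww n1 nasc; have uw := words_uniq ww; have sw := words_size ww.
have ip : index (nth 0 w 0) w = 0 by rewrite index_uniq ?sw //; lia.
have iq : index (nth 0 w 1) w = 1 by rewrite index_uniq ?sw.
exists (nth 0 w 0), (nth 0 w 1); split=> //.
case: (ltngtP (nth 0 w 0) (nth 0 w 1)) => // [lt|e]; last by move: iq; rewrite -e ip.
by case: nasc; exists (nth 0 w 0), (nth 0 w 1); rewrite sw.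
Qed.

Lemma starts_up_dup_first (w : seq nat) : w != [::] -> ~ starts_up (dup_first w).
Proof.
case: w => // x w _ [p [q [ip iq _ lt_pq]]]; have := ip; have := iq.
rewrite /= /bump ltnn add0n; case: eqP => // _.
by case: eqP => [xp|]; [case: eqP => // |]; lia.
Qed.

(** The twins [p.+1] and [p] both precede the maximum, so a pair across it uses at most one of them
    and keeps its order under doubling and collapsing. *)
Lemma max_skew_dup_first n (w : seq nat) : 0 < n -> w \in words n ->
  ~ max_skew (dup_first w) <-> ~ max_skew w.
Proof.
move=> n0 ww; have w'w := dup_first_words n0 ww; set p := head 0 w.
rewrite (not_max_skewP w'w) (not_max_skewP ww); split=> -[a [c [/andP[lt_an lt_nc] lt_c ac]]].
  have ap : a <= n.+1 by have := index_words a w'w; lia.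
  have cp : c <> p.+1 by move=> e; move: lt_nc; rewrite e /= eqxx.
  have le_p : p.+1 <= n.+1.
    by have := index_words p.+1 w'w; rewrite [index _ _]/= eqxx.
  have np : n.+1 <> p.+1 by move=> e; move: lt_an; rewrite e /= eqxx.
  have /andP[an _] : index (a - (p < a)) w < index (n.+1 - (p < n.+1)) w < n.
    by apply: (index_dup_first_twin ww) => //; [exact: ltn_trans lt_c | lia].
  have /andP[nc ln] : index (n.+1 - (p < n.+1)) w < index (c - (p < c)) w < n.
    by apply: (index_dup_first_twin ww) => //; lia.
  have en : n.+1 - (p < n.+1) = n by lia.
  by exists (a - (p < a)), (c - (p < c)); rewrite en in an nc; rewrite an nc; split=> //; lia.
exists (bump p.+1 a), (bump p.+1 c).
(* If [p] were the maximum, no letter [a] could precede it. *)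
have pn : p <> n.
  by move=> e; move: lt_an; rewrite -e /p index_head.
have le_p : p <= n.
  have := index_words p ww; rewrite index_head; lia.
have -> : n.+1 = bump p.+1 n by rewrite /bump; lia.
by rewrite !index_dup_first !ltnS lt_an lt_nc /bump; split=> //; lia.
Qed.

(** For an initial descent [p q] with [p] not [q.+1], consider [q.+1]. After the maximum N, it makes
    [p q N q.+1] a 3142. Before N, take [a < c] across N: if [c] exceeds [q.+1], then [q q.+1 N c]
    is a 1243; otherwise [a < c < q] and [q a N c] is a 3142. *)
Lemma dup_first_surj n (w : seq nat) : w \in words n.+1 ->
    avoidsT w -> ~ max_skew w -> ~ starts_up w ->
  exists2 v, v \in words n & w = dup_first v.
Proof.
move=> ww av /(not_max_skewP ww)[a [c [/andP[lt_an lt_nc] lt_c ac]]] nasc.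
have n1 : 1 < n.+1 by lia.
have [p [q [ip iq lt_qp]]] := not_starts_up_first2 ww n1 nasc.
have le_p : p <= n.+1 by have := index_words p ww; lia.
have pq : p = q.+1.
  have [//|lt_q] := eqVneq p q.+1.
  have lt_v : index q.+1 w < n.+1 by rewrite (index_words _ ww); lia.
  have neq x y : index x w <> index y w -> x <> y by move=> + e; rewrite e.
  have v_ne : index q.+1 w <> 0.
    by move=> v0; have := index_inj_words ww lt_v (etrans v0 (esym ip)); lia.
  have v_ne1 : index q.+1 w <> 1.
    by move=> v1; have := index_inj_words ww lt_v (etrans v1 (esym iq)); lia.
  have v_neN : index q.+1 w <> index n.+1 w.
    by move=> vN; have := index_inj_words ww lt_v vN; lia.
  have v1 : 1 < index q.+1 w by lia.
  have le_c : 0 < c <= n.+1 by rewrite -(index_words _ ww).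
  have le_pn : p < n.+1 by have := neq p n.+1; lia.
  have lt_n : index n.+1 w < n.+1 by rewrite (index_words _ ww) leqnn.
  have n_q : index n.+1 w <> 1.
    by move=> n_1; have := index_inj_words ww lt_n (etrans n_1 (esym iq)); lia.
  case: (ltnP (index q.+1 w) (index n.+1 w)) => [lt_vn|]; last first.
    rewrite leq_eqVlt eq_sym => /orP[/eqP //|lt_nv].
    by have := av p q n.+1 q.+1; rewrite (words_size ww); lia.
  have c_n : c <> n.+1 by apply: neq; lia.
  have [lt_vc|le_cv] := ltnP q.+1 c.
    by have := av q q.+1 n.+1 c; rewrite (words_size ww); lia.
  have c_v : c <> q.+1 by apply: neq; lia.
  have c_q : c <> q by apply: neq; lia.
  have a_q : index a w <> 1.
    by move=> a1; have := index_inj_words ww _ (etrans a1 (esym iq)); lia.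
  have a_p : index a w <> 0.
    by move=> a0; have := index_inj_words ww _ (etrans a0 (esym ip)); lia.
  by have := av q a n.+1 c; rewrite (words_size ww); lia.
have uw := words_uniq ww; have sw := words_size ww.
have [t def_w] : exists t, w = [:: p, q & t].
  move: ip iq; case: w sw {ww av lt_an lt_nc lt_c nasc uw} => [|x [|y t]] /=; try lia.
  move=> _; case: eqP => // -> _; rewrite pq; case: eqP; first lia.
  by case: eqP => // -> *; exists t.
(* [unbump p] closes the gap in values left by deleting [p]. *)
pose v := map (unbump p) (q :: t).
have def_qt : map (bump p) v = q :: t.
  rewrite -map_comp map_id_in // => x xqt; apply: unbumpK; rewrite inE.
  by apply: contraTneq uw => xp; rewrite def_w cons_uniq -xp xqt.
have w_v : w = p :: map (bump p) v by rewrite def_qt.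
have hd : (head 0 v).+1 = p by rewrite /v /= /unbump pq; lia.
exists v; last by rewrite w_v /dup_first hd.
apply: in_words.
- by apply: (@map_uniq _ _ (bump p)); move: uw; rewrite w_v /= => /andP[].
- by move: sw; rewrite w_v /= size_map => -[].
move=> x xv; have : bump p x \in w by rewrite w_v inE map_f ?orbT.
by rewrite (mem_words _ ww) /bump; lia.
Qed.

Lemma nb_straddle n : nb n.+1 (fun w => avoidsT w /\ ~ max_skew w) =
  nb n.+1 (fun w => (avoidsT w /\ ~ max_skew w) /\ starts_up w)
  + nb n (fun w => avoidsT w /\ ~ max_skew w).
Proof.
rewrite (nb_split _ _ starts_up); congr (_ + _).
have size_pos k (w : seq nat) : w \in words k -> ~ max_skew w -> 0 < k.
  by move=> ww /(not_max_skewP ww)[a [c [_ lt_c _]]]; lia.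
apply/esym/(nb_image (f := dup_first)) => [v w _ _|w ww [av sk]|w ww [[av sk] nasc]].
- exact: dup_first_inj.
- have n0 := size_pos _ _ ww sk; rewrite (avoidsT_dup_first n0 ww).
  rewrite (max_skew_dup_first n0 ww) (dup_first_words n0 ww); split=> //.
  by split=> //; apply: starts_up_dup_first; case: (w) ww n0 => // /words_size <-.
have [v vw def_w] := dup_first_surj ww av sk nasc.
have n0 : 0 < n.
  by have /(not_max_skewP ww)[a [c [lt_anc lt_c _]]] := sk; lia.
exists v; split=> //; rewrite def_w in av sk.
by split; [apply/(avoidsT_dup_first n0 vw) | apply/(max_skew_dup_first n0 vw)].
Qed.

(** The initial ascent forces [n] to precede [n.+1]; a letter [z] right after [n] and other than
    [n.+1] would complete a forbidden pattern wherever [c] lies in value. *)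
Lemma straddle_starts_up_index_max n (w : seq nat) : w \in words n.+1 ->
    avoidsT w -> ~ max_skew w -> starts_up w -> index n.+1 w <> 1 ->
  (index n w).+1 = index n.+1 w.
Proof.
move=> ww av /(not_max_skewP ww)[a [c [/andP[lt_an lt_nc] lt_c ac]]].
move=> [p [q [ip iq sw lt_pq]]] n_1; rewrite (words_size ww) in sw.
have lt_n : index n.+1 w < n.+1 by rewrite (index_words _ ww) leqnn.
have q_n : q <> n.+1 by move=> e; rewrite -e iq in n_1.
have le_q : q <= n by have := index_words q ww; rewrite iq; lia.
have le_c : c <= n.+1 by have := index_words c ww; rewrite lt_c; lia.
have c_n : c <> n.+1 by move=> e; move: lt_nc; rewrite e ltnn.
(* Otherwise [p q n.+1 x] is a 1243. *)
have beta_q x : index n.+1 w < index x w < n.+1 -> x < q.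
  move=> /andP[lt_nx lt_x]; have := av p q n.+1 x; rewrite (words_size ww) ip iq.
  have x_n : x <> n.+1 by move=> e; move: lt_nx; rewrite e ltnn.
  have x_q : x <> q by move=> e; move: lt_nx; rewrite e iq; lia.
  by have := index_words x ww; lia.
have lt_in : index n w < n.+1 by rewrite (index_words _ ww); lia.
have n_n : index n w <> index n.+1 w.
  by move=> e; have := index_inj_words ww lt_in e; lia.
have lt_nn : index n w < index n.+1 w by have := beta_q n; lia.
have n0 : index n w <> 0.
  by move=> e; have := index_inj_words ww lt_in (etrans e (esym ip)); lia.
apply/eqP; rewrite eqn_leq lt_nn leqNgt; apply/negP => lt_z.
pose z := nth 0 w (index n w).+1.
have iz : index z w = (index n w).+1.
  by rewrite index_uniq ?(words_uniq ww) // (words_size ww); lia.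
have neq x y : index x w <> index y w -> x <> y by move=> + e; rewrite e.
have lt_zn : z < n.
  have z_n : z <> n by apply: neq; lia.
  have z_n1 : z <> n.+1 by apply: neq; lia.
  by have := index_words z ww; lia.
(* Otherwise [p n z n.+1] is a 1324. *)
have lt_zp : z < p.
  have z_p : z <> p by apply: neq; lia.
  by have := av p n z n.+1; rewrite (words_size ww); lia.
have lt_cq := beta_q c; rewrite lt_nc lt_c in lt_cq; have {}lt_cq := lt_cq isT.
have c_p : c <> p by apply: neq; lia.
have c_z : c <> z by apply: neq; lia.
(* Each case gives a 3142 ending in [n.+1 c]: it starts with [q z] if [c > p], with [p z] if
   [z < c < p], and with [p a] if [c < z]. *)
have [lt_pc|le_cp] := ltnP p c.
  by have := av q z n.+1 c; rewrite (words_size ww); lia.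
have [lt_zc|le_cz] := ltnP z c.
  by have := av p z n.+1 c; rewrite (words_size ww); lia.
have a_p : index a w <> 0.
  by move=> a0; have := index_inj_words ww _ (etrans a0 (esym ip)); lia.
by have := av p a n.+1 c; rewrite (words_size ww); lia.
Qed.

Lemma nb_straddle_starts_up n :
  nb n.+1 (fun w => (avoidsT w /\ ~ max_skew w) /\ starts_up w) =
  nb n (fun w => avoidsT w /\ 0 < index (size w) w)
  + nb n (fun w => (avoidsT w /\ ~ max_skew w) /\ starts_up w).
Proof.
rewrite (nb_split _ _ (fun w => index (size w) w = 1)); congr (_ + _); apply/esym.
  apply: (nb_image (f := insert_max 1)) => [v w|w ww [av]|w ww [[[av sk] _]]].
  - exact: insert_max_inj.
  - rewrite (words_size ww) => i0.
    have n1 : 1 <= n by have := index_size n w; rewrite (words_size ww); lia.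
    have w'w := insert_max_words 1 ww; have iN := index_insert_max_new ww n1.
    have le_p : 0 < head 0 w <= n by rewrite -(index_words _ ww) index_head.
    have ip : index (head 0 w) (insert_max 1 w) = 0.
      by rewrite (index_insert_max ww n1) ?index_head //; lia.
    split=> //; rewrite (words_size w'w) iN; split=> //; split.
      split; first exact: (avoidsT_insert_max_le1 ww).
      (* The old maximum [n] is not first, so it ends up to the right of the new one, above the
         first letter. *)
      apply/(not_max_skewP w'w); exists (head 0 w), n.
      rewrite iN ip (index_insert_max ww n1) // i0.
      have := index_words n ww; rewrite leqnn andbT.
      have pn : head 0 w <> n by move=> e; move: i0; rewrite -e index_head.
      by split=> //; lia.
    exists (head 0 w), n.+1; rewrite ip iN (words_size w'w); split=> //; lia.
  rewrite (words_size ww) => iN; have [v vw def_w] := insert_max_surj ww.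
  rewrite iN in def_w; have /(not_max_skewP ww)[a [c [lt_anc lt_c ac]]] := sk.
  have n1 : 1 <= n by lia.
  exists v; split=> //; split; first by apply: (avoidsT_of_insert_max vw n1); rewrite -def_w.
  (* If [n] came first it would be [a], the only letter before [n.+1], and no [c] after [n.+1] could
     exceed it. *)
  rewrite (words_size vw) lt0n; apply/eqP => i0.
  have : index n w = 0 by rewrite def_w (index_insert_max vw n1) // i0.
  have a0 : index a w = 0 by lia.
  move=> n_0; have := index_inj_words ww _ (etrans a0 (esym n_0)).
  have := index_words c ww; rewrite lt_c; rewrite a0 iN in lt_anc *.
  by have : c <> n.+1 by [move=> e; move: lt_anc; rewrite e iN]; lia.
(* When the maximum is not second, the inverse of its deletion inserts it right after the old
   maximum. *)
apply: (nb_image (f := fun w => insert_max (index (size w) w).+1 w)).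
- by move=> v w vw ww; apply: insert_max_inj vw ww.
- move=> w ww [[av sk] [p [q [ip iq s1 lt_pq]]]]; rewrite (words_size ww) in s1 *.
  have [a [c [lt_anc lt_c ac]]] := (not_max_skewP ww).1 sk.
  have lt_i : index n w < n by rewrite (index_words _ ww); lia.
  have w'w := insert_max_words (index n w).+1 ww.
  have iN := index_insert_max_new ww lt_i.
  have idx (x : nat) : index x w < n -> index x (insert_max (index n w).+1 w) =
      index x w + (index n w < index x w).
    move=> lt_x; apply: (index_insert_max ww lt_i).
    by have := index_words x ww; rewrite lt_x; lia.
  split=> //; rewrite (words_size w'w) iN; split; last by lia.
  split; last first.
    have idp := idx p; have idq := idx q; rewrite ip iq in idp idq.
    by exists p, q; rewrite (words_size w'w); split; lia.
  have n0 : 0 < n by lia.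
  split; first exact: avoidsT_insert_max_twin.
  apply/(not_max_skewP w'w); exists a, c; rewrite iN.
  by have := idx a; have := idx c; split; lia.
move=> w ww [[[av sk] asc]]; rewrite (words_size ww) => n_1.
have n1 := straddle_starts_up_index_max ww av sk asc n_1.
have [v vw def_w] := insert_max_surj ww.
have lt_n : index n.+1 w < n.+1 by rewrite (index_words _ ww) leqnn.
have [a [c [lt_anc lt_c ac]]] := (not_max_skewP ww).1 sk.
have [p [q [ip iq s1 lt_pq]]] := asc; rewrite (words_size ww) in s1.
have idx (x : nat) : x <= n -> index x w = index x v + (index n.+1 w <= index x v).
  by rewrite {1}def_w; apply: index_insert_max.
have inv := idx n (leqnn n).
exists v; split=> //; last by rewrite (words_size vw) {1}def_w; congr insert_max; lia.
split; first split.
- by apply: (avoidsT_of_insert_max vw (i := index n.+1 w)); rewrite -?def_w.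
- have c_n : c <> n.+1 by move=> e; move: lt_anc; rewrite e ltnn andbF.
  have le_c : c <= n by have := index_words c ww; lia.
  have a_n : index a w <> index n w.
    by move=> e; have := index_inj_words ww _ e; lia.
  apply/(not_max_skewP vw); exists a, c.
  by have := idx c le_c; have := idx a; split=> //; lia.
have q_n : q <> n.+1 by move=> e; move: n_1; rewrite -e.
have le_q : q <= n by have := index_words q ww; lia.
exists p, q; rewrite (words_size vw).
have := idx p; have := idx q le_q; split=> //; lia.
Qed.

(** * Generating functions *)

Lemma one_line_inj n : injective (@one_line n).
Proof.
move=> s t /eq_in_map st; apply/permP => i.
by apply/val_inj/succn_inj/st; rewrite mem_enum.
Qed.

Lemma one_line_words n (s : 'S_n) : one_line s \in words n.
Proof.
apply: in_words.
- rewrite map_inj_in_uniq ?enum_uniq // => i j _ _ /succn_inj/val_inj.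
  exact: perm_inj.
- by rewrite size_map size_enum_ord.
by move=> x /mapP[i _ ->] /=.
Qed.

(** One-line notation is injective and both sides have n! elements. *)
Lemma perm_one_line_words n : perm_eq [seq one_line s | s <- enum 'S_n] (words n).
Proof.
have u : uniq [seq one_line s | s <- enum 'S_n].
  by rewrite (map_inj_uniq (@one_line_inj n)) enum_uniq.
apply: uniq_perm => //; first exact: permutations_uniq.
have sub : {subset [seq one_line s | s <- enum 'S_n] <= words n}.
  by move=> _ /mapP[s _ ->]; apply: one_line_words.
have le : size (words n) <= size [seq one_line s | s <- enum 'S_n].
  rewrite size_permutations ?iota_uniq // size_iota size_map -cardE.
  by rewrite card_Sn.
exact: (uniq_min_size u sub le).2.
Qed.

Lemma card_avoiders n :
  #|avoiders [:: [:: 1; 2; 4; 3]; [:: 1; 3; 2; 4]; [:: 3; 1; 4; 2]] n| = nb n avoidsT.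
Proof.
rewrite /nb -(seq.permP (perm_one_line_words n)) count_map.
rewrite -sum1_count big_enum_cond -sum1_card; apply: eq_bigl => s.
rewrite inE; apply/idP/asboolP => av; apply/(avoidsTP _) => //;
  exact: words_uniq (one_line_words s).
Qed.

Local Open Scope ring_scope.

(** * The Catalan series and its quadratic equation *)

Lemma coefX0 (F : fieldType) (a : fps F) : fps_coef (fps_X * a) 0 = 0.
Proof. by rewrite fps_coefM big_ord1 /= mul0r. Qed.

Lemma coefXS (F : fieldType) (a : fps F) n : fps_coef (fps_X * a) n.+1 = fps_coef a n.
Proof.
rewrite fps_coefM 2!big_ord_recl /= mul0r add0r mul1r subn1 /= big1 ?addr0 // => i _.
by rewrite mul0r.
Qed.

Lemma catalan_gf_rec n :
  n.+2%:R * fps_coef catalan_gf n.+1 = (4 * n + 2)%:R * fps_coef catalan_gf n :> rat.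
Proof.
rewrite /= mulVKf ?pnatr_eq0 //.
(* The ratio of consecutive central binomial coefficients. *)
have e : ('C(2 * n.+1, n.+1) * n.+1 = (4 * n + 2) * 'C(2 * n, n))%N.
  have -> : (2 * n.+1 = (2 * n).+2)%N by lia.
  have := mul_bin_diag (2 * n).+2 n; have := mul_bin_down (2 * n).+1 n.
  rewrite /=; have -> : ((2 * n).+1 - n = n.+1)%N by lia.
  by lia.
apply: (mulfI (x := n.+1%:R)); first by rewrite pnatr_eq0.
by rewrite [RHS]mulrCA mulVKf ?pnatr_eq0 // -!natrM -e mulnC.
Qed.

Lemma fps_coef_natM (F : fieldType) m (a : fps F) n :
  fps_coef (m%:R * a) n = m%:R * fps_coef a n.
Proof.
elim: m => [|m IHm]; first by rewrite !mul0r.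
by rewrite -!natr1 !mulrDl fps_coefD IHm !mul1r.
Qed.

(* The hypothesis is the differential equation [(1 - 4 x) D' = - 2 D]. *)
Lemma fps_sqr_sqrt (D : fps rat) : fps_coef D 0 = 1 ->
    (forall k, k.+1%:R * fps_coef D k.+1 = (4%:R * k%:R - 2%:R) * fps_coef D k) ->
  D ^+ 2 = 1 - 4%:R * fps_X.
Proof.
move=> d0 dS.
(* Coefficient form of (1 - 4x) E' = - 4 E for E = D^2. *)
have eS k : k.+1%:R * fps_coef (D ^+ 2) k.+1 =
    4%:R * (k%:R - 1) * fps_coef (D ^+ 2) k.
  (* This is x E' = 2 x D' D, obtained by averaging the sum with its reversal. *)
  have sym m : m%:R * fps_coef (D ^+ 2) m =
      2%:R * \sum_(i < m.+1) i%:R * fps_coef D i * fps_coef D (m - i).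
    pose S := \sum_(i < m.+1) i%:R * fps_coef D i * fps_coef D (m - i).
    have S_rev : S = \sum_(i < m.+1) (m - i)%:R * fps_coef D i * fps_coef D (m - i).
      rewrite /S (reindex_inj rev_ord_inj); apply: eq_bigr => i _ /=.
      by rewrite subSS subKn ?leq_ord // mulrAC.
    rewrite -/S mulr2n mulrDl mul1r {2}S_rev -big_split expr2 fps_coefM mulr_sumr.
    apply: eq_bigr => i _ /=; rewrite -{1}(@subnKC i m) ?leq_ord // natrD.
    by ring.
  rewrite sym big_ord_recl !mul0r add0r.
  under eq_bigr => i _ do rewrite lift0 dS subSS.
  have -> : 4%:R * (k%:R - 1) * fps_coef (D ^+ 2) k =
     4%:R * (k%:R * fps_coef (D ^+ 2) k) - 4%:R * fps_coef (D ^+ 2) k by ring.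
  rewrite sym expr2 fps_coefM !mulr_sumr -sumrB; apply: eq_bigr => i _.
  by ring.
have e0 : fps_coef (D ^+ 2) 0 = 1 by rewrite expr2 fps_coefM big_ord1 d0 mulr1.
have e1 : fps_coef (D ^+ 2) 1 = - 4%:R.
  by have := eS 0%N; rewrite e0 mul1r => ->; ring.
(* The factor [k%:R - 1] vanishes at [k = 1], which kills every coefficient from degree 2 on. *)
have e2 n : fps_coef (D ^+ 2) n.+2 = 0.
  elim: n => [|n IHn]; [have := eS 1%N | have := eS n.+2].
    by rewrite subrr mulr0 mul0r => /eqP; rewrite mulf_eq0 pnatr_eq0 => /eqP.
  by rewrite IHn mulr0 => /eqP; rewrite mulf_eq0 pnatr_eq0 => /eqP.
apply: fpsP => -[|[|n]]; rewrite fps_coefD fps_coefN fps_coef_natM fps_coef1.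
- by rewrite e0 [RHS]/= mulr0 subr0.
- by rewrite e1 [RHS]/= mulr1 sub0r.
by rewrite e2 [RHS]/= mulr0 subr0.
Qed.

(** The series D = 1 - 2xC satisfies the recurrence of the square root of 1 - 4x; expanding D^2 = 1
    - 4x and cancelling 4x gives the equation. *)
Lemma catalan_gf_eq : catalan_gf = 1 + fps_X * catalan_gf ^+ 2.
Proof.
pose D : fps rat := 1 - 2%:R * (fps_X * catalan_gf).
have D2 : D ^+ 2 = 1 - 4%:R * fps_X.
  have c0 : fps_coef catalan_gf 0 = 1 by rewrite /= bin0 mulr1; apply: invr1.
  have d0 : fps_coef D 0 = 1.
    by rewrite /D fps_coefD fps_coefN fps_coef_natM coefX0 mulr0 subr0.
  have dS k : fps_coef D k.+1 = - (2%:R * fps_coef catalan_gf k).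
    by rewrite /D fps_coefD fps_coefN fps_coef_natM coefXS fps_coef1 add0r.
  apply: fps_sqr_sqrt => // k; rewrite dS.
  case: k => [|k]; first by rewrite d0 c0; ring.
  by rewrite dS mulrN mulrCA catalan_gf_rec; rewrite -(natr1 k) natrD natrM; ring.
have e : fps_X * (4%:R * (catalan_gf - (1 + fps_X * catalan_gf ^+ 2))) = 0.
  have -> : fps_X * (4%:R * (catalan_gf - (1 + fps_X * catalan_gf ^+ 2))) =
    1 - 4%:R * fps_X - D ^+ 2 by rewrite /D; ring.
  by rewrite D2 subrr.
apply: fpsP => n; have := congr1 (fun a => fps_coef a n.+1) e.
rewrite coefXS fps_coef_natM fps_coefD fps_coefN => /eqP.
by rewrite mulf_eq0 pnatr_eq0 subr_eq0 => /eqP.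
Qed.

(** * From counts to generating functions *)

Lemma nb0 (P : seq nat -> Prop) : nb 0 P = `[< P [::] >].
Proof. by rewrite /nb /words /= addn0. Qed.

Lemma avoidsT_nil : avoidsT [::].
Proof. by move=> a b c d _; rewrite ltn0 andbF. Qed.

Lemma max_skew_nil : max_skew [::].
Proof. by []. Qed.

Local Notation gf P := (FPS (fun n => (nb n P)%:R) : fps rat).

Lemma gf_avoids132 : gf avoids132 = catalan_gf.
Proof.
set A := gf avoids132.
have A_eq : A = 1 + fps_X * (A * A).
  apply: fpsP => -[|n]; rewrite fps_coefD.
    by rewrite coefX0 addr0 /= nb0 asboolT.
  rewrite coefXS add0r fps_coefM /= nb132_rec natr_sum.
  by apply: eq_bigr => i _; rewrite natrM.
(* The equation Y = 1 + xY^2 has one solution: the difference of two solutions is annihilated by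
   this unit. *)
have u : 1 - fps_X * (A + catalan_gf) \is a GRing.unit.
  by rewrite fps_unitE fps_coefD fps_coefN coefX0 subr0 fps_coef1 oner_eq0.
apply/eqP; rewrite -subr_eq0 -(mulrI_eq0 _ (mulrI u)); apply/eqP.
have -> : (1 - fps_X * (A + catalan_gf)) * (A - catalan_gf) =
  (A - (1 + fps_X * (A * A))) - (catalan_gf - (1 + fps_X * catalan_gf ^+ 2)) by ring.
by rewrite -A_eq -catalan_gf_eq !subrr.
Qed.

Theorem theorem28 :
  avoiders_gf [:: [:: 1; 2; 4; 3]; [:: 1; 3; 2; 4]; [:: 3; 1; 4; 2]]%N =
  (1 - 3%:R * fps_X + fps_X ^+ 2) / (1 - fps_X) * catalan_gf ^+ 3.
Proof.
set X : fps rat := fps_X; set C := catalan_gf.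
set F := avoiders_gf _.
pose G := gf (fun w => avoidsT w /\ (0 < index (size w) w)%N).
pose M := gf (fun w => avoidsT w /\ ~ max_skew w).
pose U := gf (fun w => (avoidsT w /\ ~ max_skew w) /\ starts_up w).
have FE n : fps_coef F n = (nb n avoidsT)%:R by rewrite /= card_avoiders.
have F_G : F = 1 + X * F + G.
  apply: fpsP => -[|n]; rewrite !fps_coefD FE.
    by rewrite coefX0 /= !nb0 (asboolT avoidsT_nil) asboolF ?addr0 // => -[].
  by rewrite coefXS FE nbT_max_first natrD addrC add0r.
have F_M : F = 1 + X * (C * F) + M.
  apply: fpsP => -[|n]; rewrite !fps_coefD FE.
    rewrite coefX0 /= !nb0 (asboolT avoidsT_nil) asboolF ?addr0 // => -[_].
    by apply; exact: max_skew_nil.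
  rewrite coefXS add0r nbT_split natrD; congr (_ + _).
  rewrite -[C]gf_avoids132 fps_coefM natr_sum.
  by apply: eq_bigr => i _; rewrite natrM -FE.
have M_U : M = X * M + U.
  apply: fpsP => -[|n]; rewrite !fps_coefD.
    rewrite coefX0 /= !nb0 !asboolF ?addr0 //.
      by case=> -[_]; case; exact: max_skew_nil.
    by case=> _; apply; exact: max_skew_nil.
  by rewrite coefXS /= nb_straddle natrD addrC.
have U_G : U = X * (G + U).
  apply: fpsP => -[|n].
    by rewrite coefX0 /= nb0 asboolF // => -[[_]]; case; exact: max_skew_nil.
  by rewrite coefXS fps_coefD /= nb_straddle_starts_up natrD.
have C_eq : C = 1 + X * C ^+ 2 := catalan_gf_eq.
have u : 1 - X \is a GRing.unit.
  by rewrite fps_unitE fps_coefD fps_coefN [fps_coef X 0]/= subr0 oner_eq0.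
(* The factor left by the elimination below is the inverse of [C ^+ 3]; the product differs from 1
   by a multiple of the quadratic equation of [C]. *)
have C3 : C ^+ 3 * ((1 - X) * (1 - X * C) - X) = 1.
  have -> : C ^+ 3 * ((1 - X) * (1 - X * C) - X) =
    1 + ((1 - X) * C ^+ 2 + 1 + C) * (C - (1 + X * C ^+ 2)) by ring.
  by rewrite -C_eq subrr mulr0 addr0.
(* A combination of the four equations that eliminates [G], [M] and [U]. *)
have lin : (1 - X) * F * ((1 - X) * (1 - X * C) - X) = 1 - 3%:R * X + X ^+ 2.
  have -> : (1 - X) * F * ((1 - X) * (1 - X * C) - X) = 1 - 3%:R * X + X ^+ 2
    + (1 - X) ^+ 2 * (F - (1 + X * (C * F) + M)) + (1 - X) * (M - (X * M + U))
    + (U - X * (G + U)) - X * (F - (1 + X * F + G)) by ring.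
  by rewrite -F_M -M_U -U_G -F_G !subrr !mulr0 !addr0.
rewrite mulrAC; apply: (canRL (mulrK u)).
transitivity (F * (1 - X) * (C ^+ 3 * ((1 - X) * (1 - X * C) - X))).
  by rewrite C3 mulr1.
by rewrite -lin; ring.
Qed.
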